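(* Let $(X,d)$ be a compact metric space such that each non-trivial component of $X$ is an arc $[a,b]$ for which the set $(a,b)=[a,b]\setminus\{a,b\}$ is open in $X$. Then $X$ is homeomorphic to a subset of $\mathbb{R}$.
   Context: A component (connected component) is non-trivial if it has more than one point. An arc is a homeomorphic image of a closed interval of $\mathbb{R}$ with distinct endpoints; it is denoted by $[a,b]$, where $a,b$ are the images of the endpoints of the interval and are called the endpoints of the arc. *)

(* Defs.v *)
From mathcomp Require Import all_boot all_order all_algebra.
From mathcomp Require Import all_classical all_reals all_analysis.

Set Implicit Arguments.
Unset Strict Implicit.
Unset Printing Implicit Defensive.

Import Order.TTheory GRing.Theory Num.Theory.
Import numFieldNormedType.Exports.

Local Open Scope classical_set_scope.
Local Open Scope ring_scope.

Definition homeomorphism (S T : topologicalType) (f : S -> T) : Prop :=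
  continuous f /\
  exists g : T -> S, [/\ cancel f g, cancel g f & continuous g].

Definition homeomorphic (S T : topologicalType) : Prop :=
  exists f : S -> T, homeomorphism f.

Definition nontrivial (X : Type) (C : set X) : Prop :=
  exists x y : X, [/\ C x, C y & x <> y].

(* [C] is an arc [[a, b]]. Both the interval and [C] are taken as subspaces
   (via [set_type]); as [s < t], the quantifications over [u] determine the
   images of the two endpoints. *)
Definition is_arc (R : realType) (X : topologicalType) (C : set X) (a b : X)
    : Prop :=
  exists (s t : R) (f : set_type `[s, t]%classic -> set_type C),
    [/\ s < t,
        homeomorphism f,
        forall u, \val u = s -> \val (f u) = a &
        forall u, \val u = t -> \val (f u) = b].

(* Main.v *)
(* It suffices to find a continuous injection X -> R. Components of X are
   quasi-components, and X has countably many clopen sets U k and countably many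
   non-trivial components C n. The open arc being open, a clopen splitting of
   its complement separates its endpoints, which gives a continuous
   q n : X -> [0, 1], injective on C n and valued in {0, 1} off C n.

   The cells of X are cut successively by the U k, each piece receiving a
   base 3 digit, so that components get distinct digit sequences. In a cell
   containing some C n (take the least such n) the piece containing C n gets the
   digit 1, and the other piece is cut again according to q n = 0 or q n = 1,
   with digits 0 and 2. Thus in the lexicographic order the points close to one
   end of C n lie below it, those close to the other end above it, and q n,
   extended by 0 below and by 1 above the cell of C n, is continuous and
   monotone. All these functions being monotone for one order on X and together
   separating points, a convergent positive combination of them is injective. *)
Require Import Defs.
From HB Require Import structures.
From mathcomp Require Import all_boot all_order all_algebra.
From mathcomp Require Import all_classical all_reals all_analysis.
From mathcomp Require Import lra zify.

Import Order.TTheory GRing.Theory Num.Theory.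
Import numFieldNormedType.Exports.

Local Open Scope classical_set_scope.
Local Open Scope ring_scope.

(** * Quasi-components of compact Hausdorff spaces *)

(** [F] consists of the relatively clopen subsets of [K] containing [p], and [Q], its intersection,
    is the quasi-component of [p]. Without a splitting [q] would lie in [Q], and compactness makes
    [Q] connected, against the hypothesis. *)
Lemma quasicomponent_separation (X : topologicalType) (K : set X) (p q : X) :
  hausdorff_space X -> compact [set: X] -> closed K -> K p -> K q ->
  (forall S, S `<=` K -> connected S -> S p -> ~ S q) ->
  exists A B : set X,
    [/\ closed A, closed B, A `|` B = K, A `&` B = set0 & A p /\ B q].
Proof.
move=> hX cX clK Kp Kq sepK; apply: contrapT => noAB.
pose F := [set A : set X | [/\ closed A, A `<=` K, closed (K `\` A) & A p]].
pose Q := \bigcap_(A in F) A.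
have FK : F K by split => //; rewrite setDv; exact: closed0.
have FI A B : F A -> F B -> F (A `&` B).
  move=> [cA AK cKA Ap] [cB BK cKB Bp]; split => //.
  - exact: closedI.
  - by move=> x [/AK].
  - by rewrite setDIr; exact: closedU.
have Qp : Q p by move=> A [].
have Qq : Q q.
  move=> A [cA AK cKA Ap]; apply: contrapT => nAq; apply: noAB.
  exists A, (K `\` A); split => //; first exact: setDUK.
  by rewrite setDE setICA setICr setI0.
have QK : Q `<=` K by move=> x /(_ _ FK).
have clQ : closed Q by apply: closed_bigI => A [].
apply: (sepK Q QK _ Qp Qq); apply/connectedP => E [E0 QE sepE].
have clE b : closed (E b).
  rewrite closure_id eqEsubset; split; first exact: subset_closure.
  move=> x Ex; have : Q x.
    rewrite ((closure_id Q).1 clQ) QE; apply: closureS Ex.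
    by case: b => ?; [right|left].
  have [s1 s2] := sepE.
  by rewrite QE; case: b Ex => Ex [|] // Ey; exfalso; [
    have : (E false `&` closure (E true)) x by [] ; rewrite s2 |
    have : (closure (E false) `&` E true) x by [] ; rewrite s1].
have disE : E false `&` E true = set0 by exact: separated_disjoint.
wlog Ep : E E0 QE sepE clE disE / E false p.
  move=> wl; have : Q p by []; rewrite QE => -[Ep|Ep]; first exact: (wl E).
  apply: (wl (E \o negb)) => //=.
  - by rewrite QE setUC.
  - by rewrite separatedC.
  - by rewrite setIC.
have : set_nbhs (E false) (~` E true).
  apply/set_nbhsP; exists (~` E true); split => //.
    by apply: closed_openC; exact: clE.
  by apply/disjoints_subset.
move=> /(compact_normal hX cX (clE false)) [V /set_nbhsP[G [oG EG GV]] VE].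
have {}VE : closure G `<=` ~` E true by apply: subset_trans VE; exact: closureS.
(* The boundary of [G] misses [Q]. If every member of [F] met it, these traces would form a filter
   base, clustering at a boundary point that lies in [Q]. *)
have [A FA AG] : exists2 A, F A & A `&` (closure G `\` G) = set0.
  apply: contrapT => noA.
  pose H := filter_from F (fun A => A `&` (closure G `\` G)).
  have PH : ProperFilter H.
    apply: filter_from_proper.
      apply: filter_from_filter; first by exists K.
      move=> A B FA FB; exists (A `&` B); first exact: FI.
      by move=> x [[Ax Bx] Gx].
    move=> A FA; apply/set0P/negP => /eqP A0; apply: noA; by exists A.
  have [|x [_ Hx]] := cX H PH; first by exists K.
  have clA A : F A -> (A `&` (closure G `\` G)) x.
    move=> FA; have cl : closed (A `&` (closure G `\` G)).
      apply: closedI; first by case: FA.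
      by apply: closedI; [exact: closed_closure|exact: open_closedC].
    rewrite ((closure_id _).1 cl) => B Bx; apply: Hx => //.
    by exists A.
  have : Q x by move=> A /clA[].
  have [_ [cGx nGx]] := clA _ FK.
  by rewrite QE => -[/EG//|]; exact: VE.
have [cA AK cKA Ap] := FA.
have AGE : A `&` G = A `&` closure G.
  rewrite eqEsubset; split => x [Ax Gx]; split => //.
    exact: subset_closure.
  apply: contrapT => nGx; suff : (A `&` (closure G `\` G)) x by rewrite AG.
  by [].
(* Since [A] misses the boundary of [G], cutting it by [G] keeps it relatively clopen; hence [Q]
   lies in [G], which is disjoint from [E true]. *)
have FAG : F (A `&` G).
  split => //.
  - by rewrite AGE; apply: closedI => //; exact: closed_closure.
  - by move=> x [/AK].
  - rewrite setDIr; apply: closedU => //; rewrite setDE.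
    by apply: closedI => //; exact: open_closedC.
  - by split => //; exact: EG.
have [x Ex] := E0 true.
have /(_ _ FAG)[Ax Gx] : Q x by rewrite QE; right.
by apply: (VE x) => //; exact: subset_closure.
Qed.

(** * Injective sums of comonotone functions *)

Section comonotone_series.
Context {R : realType} {X : topologicalType} (f : nat -> X -> R).
Hypothesis f_continuous : forall k, continuous (f k).
Hypothesis f_itv : forall k x, 0 <= f k x <= 1.
Hypothesis f_comonotone : forall x y, x <> y ->
  (forall k, f k x <= f k y) \/ (forall k, f k y <= f k x).
Hypothesis f_separates : forall x y, x <> y -> exists k, f k x <> f k y.

Let u (x : X) (k : nat) : R := f k x / 2 ^+ k.+1.

Let u_ge0 x k : 0 <= u x k.
Proof. by rewrite /u divr_ge0 ?exprn_ge0//; case/andP: (f_itv k x). Qed.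

Let u_le x k : u x k <= 1 / (2 ^ (k + 1))%:R.
Proof.
rewrite /u natrX addn1 ler_pM2r ?invr_gt0 ?exprn_gt0//.
by case/andP: (f_itv k x).
Qed.

Let cvg_u x : cvgn (series (u x)).
Proof.
apply: (series_le_cvg (u_ge0 x) _ (u_le x)) => [k|]; first by rewrite divr_ge0.
by apply/cvg_ex; exists (1 / 2 ^+ 0); exact: (cvg_geometric_series_half 1 0).
Qed.

Let F (x : X) : R := limn (series (u x)).

Let F_ge x n : series (u x) n <= F x.
Proof.
apply: nondecreasing_cvgn_le; last exact: cvg_u.
exact: nondecreasing_series.
Qed.

(** The right-hand side is nonincreasing in [n], each term being at most its share of the geometric
    tail, and it dominates all later partial sums. *)
Let F_le x n : F x <= series (u x) n + 1 / 2 ^+ n.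
Proof.
have noninc : nonincreasing_seq (fun n => series (u x) n + 1 / 2 ^+ n).
  apply/nonincreasing_seqP => m; rewrite seriesSr -addrA lerD2l.
  have := u_le x m; rewrite natrX addn1 !div1r [in X in _ -> X]exprS invfM.
  rewrite exprS invfM; lra.
apply: limr_le; first exact: cvg_u.
near=> m; have nm : (n <= m)%N by near: m; exists n.
by apply: le_trans (noninc _ _ nm); rewrite lerDl divr_ge0// exprn_ge0.
Unshelve. all: by end_near. Qed.

Let half_expn_lt (e : R) : 0 < e ->
  exists n, forall m, (n <= m)%N -> 1 / 2 ^+ m < e.
Proof.
move=> e0; have [n] := ltr_add_invr e0; rewrite add0r => ne.
exists n => m nm; apply: le_lt_trans ne.
rewrite div1r lef_pV2 ?posrE ?exprn_gt0//.
by rewrite -natrX ler_nat (leq_ltn_trans nm)// ltn_expl.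
Qed.

Let series_continuous n : continuous (fun x => series (u x) n).
Proof.
elim: n => [|n IH].
  rewrite (_ : (fun _ => _) = cst 0); first exact: cst_continuous.
  by apply/funext => x; rewrite /series/= big_geq.
rewrite (_ : (fun _ => _) = (fun x => series (u x) n + u x n)); last first.
  by apply/funext => x; rewrite seriesSr.
move=> x; apply: cvgD; first exact: IH.
by apply: cvgMr_tmp; exact: f_continuous.
Qed.

Let F_continuous : continuous F.
Proof.
move=> x; apply/cvgrPdist_lt => e e0.
have e20 : 0 < e / 2 by rewrite divr_gt0.
(* The [n]-th partial sum is within [e / 2] of [F] uniformly in the point, so [F] inherits its
   continuity. *)
have [n /(_ _ (leqnn n)) ne] := half_expn_lt _ e20.
have := [elaborate series_continuous n x].
move=> /(@cvgrPdist_lt _ _ _ (nbhs x))/(_ (e / 2) e20); apply: filterS => y Sxy.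
move: Sxy; rewrite !ltr_norml => /andP[S1 S2].
have := F_ge x n; have := F_ge y n; have := F_le x n; have := F_le y n.
move=> a b c d; apply/andP; split; lra.
Qed.

(** Comonotonicity excludes cancellation: the gap [d] opened by the term [k] persists in all later
    partial sums, and a far enough tail is smaller than [d]. *)
Let F_lt x y : x <> y -> (forall k, f k x <= f k y) -> F x < F y.
Proof.
move=> xy fxy; have [k fk] := f_separates _ _ xy.
pose d : R := (f k y - f k x) / 2 ^+ k.+1.
have d0 : 0 < d.
  by rewrite divr_gt0 ?exprn_gt0// subr_gt0 lt_neqAle fxy andbT; exact/eqP.
have Sd n : (k < n)%N -> series (u x) n + d <= series (u y) n.
  elim: n => // n IH; rewrite ltnS leq_eqVlt !seriesSr => /orP[/eqP<-|/IH].
    rewrite -addrA /d /u mulrBl subrKC lerD2r; apply: ler_sum => i _.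
    by rewrite ler_pM2r ?invr_gt0 ?exprn_gt0.
  by move=> /lerD; rewrite addrAC; apply; rewrite ler_pM2r ?invr_gt0 ?exprn_gt0.
have [n nd] := half_expn_lt _ d0.
have := F_le x (maxn n k.+1); have := F_ge y (maxn n k.+1).
have := nd _ (leq_maxl n k.+1); have := Sd _ (leq_maxr n k.+1); lra.
Qed.

Lemma comonotone_embedding : exists g : X -> R, continuous g /\ injective g.
Proof.
exists F; split => // x y Fxy; apply: contrapT => xy.
case: (f_comonotone _ _ xy) => fxy.
  by have := F_lt _ _ xy fxy; rewrite Fxy ltxx.
by have := F_lt _ _ (nesym xy) fxy; rewrite Fxy ltxx.
Qed.

End comonotone_series.

(** * The coordinate attached to an arc component *)

(** The complement [K] of the open arc splits into closed sets [A] and [B] containing [a] and [b].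
    The normalised arc parameter on [C], the value 0 on [A] and the value 1 on [B] agree on overlaps
    and are pasted together. *)
Lemma arc_coordinate (R : realType) (X : topologicalType) (x a b : X) :
  hausdorff_space X -> compact [set: X] ->
  let C := connected_component [set: X] x in
  is_arc R C a b -> open (C `\` [set a; b]) ->
  exists q : X -> R, [/\ continuous q, forall y, 0 <= q y <= 1,
    forall y z, C y -> C z -> q y = q z -> y = z &
    forall y, ~ C y -> q y = 0 \/ q y = 1].
Proof.
move=> hX cX C [s [t [f [st [cf [g [fK gK cg]]] fs ft]]]] oab.
have clC : closed C by apply: component_closed; exact: closedT.
have its : s \in `[s, t]%classic by rewrite inE /= in_itv /= lexx ltW.
have itt : t \in `[s, t]%classic by rewrite inE /= in_itv /= lexx ltW.
pose us : set_type `[s, t]%classic := exist _ s its.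
pose ut : set_type `[s, t]%classic := exist _ t itt.
have {}fs : \val (f us) = a by exact: fs.
have {}ft : \val (f ut) = b by exact: ft.
have Ca : C a by rewrite -fs; exact: set_valP.
have Cb : C b by rewrite -ft; exact: set_valP.
have ab : a <> b.
  rewrite -fs -ft => /val_inj /(can_inj fK) /(congr1 val) /= /eqP.
  by rewrite lt_eqF.
pose K := ~` (C `\` [set a; b]).
have Kab y : C y -> K y -> y = a \/ y = b.
  by move=> Cy nK; apply: contrapT => yab; apply: nK.
have [||||A [B [clA clB ABK AB0 [Aa Bb]]]] :=
  quasicomponent_separation X K a b hX cX.
- exact: open_closedC.
- by move=> [_]; apply; left.
- by move=> [_]; apply; right.
(* Such an [S] lies in the component [C], hence in [[set a; b]]; the point [a] is then clopen in
   [S], so [S] reduces to it. *)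
- move=> S SK cS Sa Sb.
  have SC : S `<=` C.
    rewrite /C (same_connected_component Ca).
    by apply: connected_component_max.
  have aS : [set a] = S.
    apply: cS; first by exists a.
      exists (~` [set b]).
        exact/closed_openC/accessible_closed_set1/hausdorff_accessible.
      rewrite eqEsubset; split => y; first by move=> ->; split.
      by move=> [Sy yb]; case: (Kab y (SC _ Sy) (SK _ Sy)).
    exists [set a].
      exact/accessible_closed_set1/hausdorff_accessible.
    by rewrite eqEsubset; split => y; [move=> ->|case].
  by apply: ab; move: Sb; rewrite -aS.
pose q y := match pselect (C y) with
  | left Cy => (\val (g (exist _ y (mem_set Cy))) - s) / (t - s)
  | right _ => if `[< A y >] then 0 else 1
  end.
have ts0 : t - s > 0 by rewrite subr_gt0.
have qC (v : set_type C) : q (\val v) = (\val (g v) - s) / (t - s).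
  rewrite /q; case: pselect => [Cv|]; last by case; exact: set_valP.
  by congr ((\val (g _) - s) / _); apply: val_inj.
have qA y : A y -> q y = 0.
  move=> Ay; have [Cy|nCy] := pselect (C y).
    have [|->|yb] := Kab y Cy; first by rewrite -ABK; left.
      by rewrite -fs qC fK /= subrr mul0r.
    by have : (A `&` B) y by [split => //; rewrite yb]; rewrite AB0.
  by rewrite /q; case: pselect => // _; rewrite asboolT.
have qB y : B y -> q y = 1.
  move=> By; have nAy : ~ A y.
    by move=> Ay; have : (A `&` B) y by []; rewrite AB0.
  have [Cy|nCy] := pselect (C y).
    have [|ya|->] := Kab y Cy; first by rewrite -ABK; right.
      by rewrite ya in nAy.
    by rewrite -ft qC fK /= divff// gt_eqF.
  by rewrite /q; case: pselect => // _; rewrite asboolF.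
have nC y : ~ C y -> A y \/ B y.
  move=> nCy; have : K y by case.
  by rewrite -ABK.
exists q; split.
- have CAB : C `|` (A `|` B) = setT.
    by apply/seteqP; split=> // y _; have [|/nC] := pselect (C y); [left|right].
  suff : {within C `|` (A `|` B), continuous q}.
    by rewrite CAB => /(continuous_subspace_setT q).2.
  apply: withinU_continuous => //; first exact: closedU.
    apply/subspace_sigL_continuousP.
    rewrite (_ : sigL C q = (fun v => (\val (g v) - s) / (t - s))).
      have hc : continuous (fun v : set_type C => \val (g v)).
        move=> v; apply: continuous_comp; first exact: cg.
        exact: initial_continuous.
      have rc : continuous (fun r : R => (r - s) / (t - s)).
        move=> r; apply: cvgMr_tmp.
        by apply: cvgB; [exact: cvg_id|exact: cvg_cst].
      by move=> v; exact: (continuous_comp (hc v) (rc _)).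
    by apply/funext => v; exact: qC.
  have cst_within c (D : set X) : (forall y, D y -> q y = c) ->
      {within D, continuous q}.
    move=> qD; have qE : {in D, cst c =1 q} by move=> y /set_mem /qD ->.
    apply: (subspace_eq_continuous qE).
    exact/continuous_subspaceT/cst_continuous.
  by apply: withinU_continuous => //;
    [exact: cst_within qA|exact: cst_within qB].
- move=> y; have [Cy|/nC[/qA|/qB] ->] := pselect (C y); rewrite ?lexx ?ler01//.
  pose v : set_type C := exist _ y (mem_set Cy).
  have := set_valP (g v); rewrite -[y]/(\val v) qC /= in_itv /= => /andP[sg gt].
  by rewrite divr_ge0 ?subr_ge0 ?(ltW st)//= ler_pdivrMr// mul1r lerD2r.
- move=> y z Cy Cz.
  pose v : set_type C := exist _ y (mem_set Cy).
  pose w : set_type C := exist _ z (mem_set Cz).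
  rewrite -[y]/(\val v) -[z]/(\val w) !qC => /mulIf; rewrite invr_eq0 gt_eqF//.
  by move=> /(_ isT)/addIr/val_inj/(can_inj gK) ->.
- by move=> y /nC[/qA|/qB]; [left|right].
Qed.

(** * Compactness: embeddings into the line and countability *)

Lemma compact_injective_homeomorphic (R : realType) (X : topologicalType)
    (g : X -> R) : compact [set: X] -> continuous g -> injective g ->
  homeomorphic X (set_type (range g)).
Proof.
move=> cX cg ig.
pose G x : set_type (range g) := exist _ (g x) (mem_set (imageT g x)).
have GE x : set_val (G x) = g x by [].
have surjG (y : set_type (range g)) : exists x, G x = y.
  have [x _ gxy] := set_mem (valP y).
  by exists x; apply: val_inj.
pose H y := projT1 (cid (surjG y)).
have HK y : G (H y) = y by rewrite /H; case: cid.
have GK x : H (G x) = x by apply: ig; rewrite -[LHS]GE HK.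
exists G; split.
  by apply: continuous_comp_initial => x; exact: cg.
exists H; split => //.
apply/continuous_closedP => A cA.
(* The inverse is continuous because [g] is a closed map: the image of a closed set is compact,
   hence closed in [R]. *)
have -> : H @^-1` A = set_val @^-1` (g @` A).
  rewrite eqEsubset; split => y /=.
    by move=> Ay; exists (H y) => //; rewrite -[RHS](congr1 set_val (HK y)).
  move=> [x Ax gxy]; suff -> : H y = x by [].
  by rewrite -(GK x); congr H; apply: val_inj.
apply: preimage_closed; first by move=> y _; exact: initial_continuous.
apply: compact_closed; first exact: Rhausdorff.
apply: continuous_compact; first exact: continuous_subspaceT.
by apply: subclosed_compact cX _.
Qed.

(* The countability lemmas of the library require a pointed space. *)
Definition pointed_at (X : Type) (x0 : X) : Type := X.

HB.instance Definition _ (R : realType) (X : pseudoMetricType R) (x0 : X) :=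
  PseudoMetric.copy (pointed_at X x0) X.
HB.instance Definition _ (R : realType) (X : pseudoMetricType R) (x0 : X) :=
  isPointed.Build (pointed_at X x0) x0.

Lemma compact_clopen_seq (R : realType) (X : pseudoMetricType R) :
  compact [set: X] -> exists U : nat -> set X,
    (forall k, clopen (U k)) /\ (forall V, clopen V -> exists k, U k = V).
Proof.
move=> cX; have [[x0 _]|noX] := pselect (exists x : X, True); last first.
  exists (fun=> set0); split=> [_|V _]; first exact: clopen0.
  by exists 0%N; apply/seteqP; split=> x; case: noX; exists x.
have [U] := @clopen_surj R (pointed_at X x0) cX.
exists U; split=> [k|V cV]; first exact: (@funS _ _ _ _ U k I).
by have [k _ UkV] := @surj _ _ _ _ U V cV; exists k.
Qed.

Lemma compact_dense_seq (R : realType) (X : pseudoMetricType R) (x0 : X) :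
  compact [set: X] -> exists e : nat -> X,
    forall V, open V -> V !=set0 -> exists n, V (e n).
Proof.
move=> cX.
have [B cB [oB bB]] := @compact_second_countable R (pointed_at X x0) cX.
have B0 : B !=set0.
  by have [V [BV _] _] := bB x0 setT filterT; exists V.
have [B_eq0|[c]] := pfcard_geP cB; first by rewrite B_eq0 in B0; case: B0.
have Vc n : exists x, c n !=set0 -> c n x.
  (* One point is picked in each set of a countable base; [x0] is a dummy value for the empty
     ones. *)
  have [[x cx]|nc] := pselect (c n !=set0); first by exists x.
  by exists x0.
exists (fun n => projT1 (cid (Vc n))) => V oV [x Vx].
have [W [BW Wx] WV] := bB x V (open_nbhs_nbhs (conj oV Vx)).
have [n _ cnW] := @surj _ _ _ _ c W BW.
exists n; apply: WV; case: cid => y /=; rewrite cnW; apply.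
by exists x.
Qed.

(** * Ternary codes and the lexicographic order *)

Section code.
Context {R : realType} {X : topologicalType}.
(* Each non-trivial component is that of [e n] for exactly one [n] with [P n]. *)
Variables (U : nat -> set X) (e : nat -> X) (P : nat -> Prop).
Variable (q : nat -> X -> R).
Local Notation comp := (connected_component [set: X]).
Hypothesis U_clopen : forall k, clopen (U k).
Hypothesis U_separates : forall x y, ~ comp x y -> exists k, U k x /\ ~ U k y.
Hypothesis P_inj : forall n m, P n -> P m -> comp (e n) (e m) -> n = m.
Hypothesis P_cover : forall x y, x <> y -> comp x y ->
  exists n, P n /\ comp (e n) x.
Hypothesis q_continuous : forall n, P n -> continuous (q n).
Hypothesis q_itv : forall n x, P n -> 0 <= q n x <= 1.
Hypothesis q_inj : forall n x y, P n -> comp (e n) x -> comp (e n) y ->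
  q n x = q n y -> x = y.
Hypothesis q_out : forall n x, P n -> ~ comp (e n) x -> q n x = 0 \/ q n x = 1.

(* [N] stands for [code k] and [c] for one of its values, i.e. for a cell. *)
Definition active (N : X -> nat) (c : nat) : option nat :=
  match pselect (exists n, `[< P n /\ N (e n) = c >]) with
  | left ex => Some (ex_minn ex)
  | right _ => None
  end.

Lemma active_Some (N : X -> nat) c n : active N c = Some n ->
  P n /\ N (e n) = c.
Proof.
rewrite /active; case: pselect => // ex [<-].
by case: ex_minnP => m /asboolP.
Qed.

(** The test [q n x == 1] is reached only when [U k] separates [x] from [e n]. Then [x] is outside
    the component of [e n], so [q n x] is 0 or 1. *)
Definition digit (k : nat) (N : X -> nat) (x : X) : nat :=
  match active N (N x) with
  | Some n => if `[< U k x <-> U k (e n) >] then 1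
              else if q n x == 1 then 2 else 0
  | None => `[< U k x >]
  end.

Fixpoint code (k : nat) (x : X) : nat :=
  if k is j.+1 then 3 * code j x + digit j (code j) x else 0.

Lemma digit_le2 k N x : (digit k N x <= 2)%N.
Proof.
rewrite /digit; case: active => [n|]; last by case: `[<_>].
by do !case: ifP.
Qed.

Lemma code_lt k x : (code k x < 3 ^ k)%N.
Proof.
elim: k => //= k IH; have := digit_le2 k (code k) x; rewrite expnS; lia.
Qed.

(** Digits are at most 2, so no later digit can undo a strict inequality between prefixes: comparing
    codes is comparing lexicographically. *)
Lemma code_mono x y k j : (k <= j)%N -> (code k x < code k y)%N ->
  (code j x < code j y)%N.
Proof.
elim: j => [|j IH]; first by rewrite leqn0 => /eqP ->.
rewrite leq_eqVlt => /orP[/eqP ->//|]; rewrite ltnS => kj /(IH kj) /= cxy.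
have := digit_le2 j (code j) x; lia.
Qed.

Lemma code_neq_mono x y k j : (k <= j)%N -> code k x <> code k y ->
  code j x <> code j y.
Proof.
move=> kj /eqP; rewrite neq_ltn => /orP[] /(code_mono _ _ _ _ kj); lia.
Qed.

Definition prec x y := exists k, (code k x < code k y)%N.

Lemma prec_le x y : prec x y -> forall k, (code k x <= code k y)%N.
Proof.
move=> [k kxy] j; rewrite leqNgt; apply/negP => jyx.
have := code_mono _ _ _ _ (leq_maxl k j) kxy.
have := code_mono _ _ _ _ (leq_maxr k j) jyx; lia.
Qed.

Lemma near_iff_clopen (V : set X) x : clopen V ->
  \forall y \near x, V y <-> V x.
Proof.
move=> [oV cV]; have [Vx|nVx] := pselect (V x).
  by apply: filterS (open_nbhs_nbhs (conj oV Vx)) => y.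
have oVC : open (~` V) by exact: closed_openC.
by apply: filterS (open_nbhs_nbhs (conj oVC nVx)) => y.
Qed.

Lemma comp_clopen (V : set X) x y : clopen V -> comp x y -> (V x <-> V y).
Proof.
have sub a b : clopen V -> comp a b -> V a -> V b.
  move=> [oV cV] ab Va.
  suff CV : comp a `&` V = comp a by move: ab; rewrite -CV => -[].
  apply: component_connected; [|by exists V|by exists V].
  by exists a; split => //; exact: connected_component_refl.
by move=> cV xy; split; apply: sub => //; exact: connected_component_sym.
Qed.

Lemma opposite_out k n x : ~ (U k x <-> U k (e n)) -> ~ comp (e n) x.
Proof.
by move=> Ux enx; apply: Ux; apply: iff_sym; exact: comp_clopen.
Qed.

Lemma digit_near k (N : X -> nat) (x : X) : (\forall y \near x, N y = N x) ->
  \forall y \near x, digit k N y = digit k N x.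
Proof.
move=> Nx; have Uxy := near_iff_clopen _ x (U_clopen k).
rewrite /digit; case En : (active N (N x)) => [n|]; last first.
  by apply: filterS2 Nx Uxy => y -> Uyx; rewrite En (asbool_equiv_eq Uyx).
have [Pn _] := active_Some _ _ _ En.
case: asboolP => Ux.
  apply: filterS2 Nx Uxy => y -> Uyx; rewrite En asboolT//.
  exact: iff_trans Uyx Ux.
(* Near [x] the values of [q n] are 0 or 1 and differ by less than 1, so they coincide. *)
have qx : \forall y \near x, `|q n x - q n y| < 1.
  by have /cvgrPdist_lt/(_ _ ltr01) := [elaborate q_continuous n Pn x].
apply: filterS3 Nx Uxy qx => y -> Uyx qxy.
have Uy : ~ (U k y <-> U k (e n)).
  by move=> Uye; apply: Ux; exact: iff_trans (iff_sym Uyx) Uye.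
rewrite En asboolF//.
have [] := q_out n x Pn (opposite_out _ _ _ Ux);
have [] := q_out n y Pn (opposite_out _ _ _ Uy) => qy qx;
  rewrite qx qy // in qxy *; move: qxy.
  by rewrite sub0r normrN normr1 ltxx.
by rewrite subr0 normr1 ltxx.
Qed.

Lemma code_near k x : \forall y \near x, code k y = code k x.
Proof.
elim: k => [|k IH] /=; first exact: nearW.
by apply: filterS2 IH (digit_near k _ _ IH) => y -> ->.
Qed.

(** Codes are locally constant, so their level sets are clopen and contain whole components. *)
Lemma code_comp x y k : comp x y -> code k x = code k y.
Proof.
pose V := [set z : X | code k z = code k x].
have cV : clopen V.
  split.
    rewrite openE => z Vz; rewrite /interior.
    by apply: filterS (code_near k z) => w; rewrite /V /= => ->.
  rewrite -[V]setCK; apply: open_closedC.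
  rewrite openE => z Vz; rewrite /interior.
  by apply: filterS (code_near k z) => w; rewrite /V /= => ->.
by move=> /(comp_clopen _ _ _ cV)[/(_ erefl)].
Qed.

(** If [x] and [y] still share a cell when the [U k] separating them is used, exactly one of them is
    on the side of the active [e n] and gets the digit 1. With no active index the digits are 1 and
    0. *)
Lemma code_separates x y : ~ comp x y -> exists k, code k x <> code k y.
Proof.
move=> /U_separates[k [Ux nUy]].
have [cxy|] := pselect (code k x = code k y); last by exists k.
exists k.+1; rewrite /= cxy /digit cxy.
case En : active => [n|]; last by rewrite asboolT// asboolF//; lia.
have [Une|nUne] := pselect (U k (e n)).
  rewrite asboolT// asboolF; last by tauto.
  by case: ifP => _; lia.
rewrite asboolF ?asboolT//; last by tauto.
by case: ifP => _; lia.
Qed.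

(** Index [n] becomes the least one in its cell once the codes separate [e n] from the finitely many
    earlier [e m] with [P m]. *)
Lemma active_eventually n : P n -> exists K, forall k, (K <= k)%N ->
  active (code k) (code k (e n)) = Some n.
Proof.
move=> Pn.
suff [K KP] : exists K, forall m, (m < n)%N -> P m ->
    forall k, (K <= k)%N -> code k (e m) <> code k (e n).
  exists K => k Kk; rewrite /active; case: pselect => [ex|]; last first.
    by case; exists n; apply/asboolP.
  congr Some; case: ex_minnP => m /asboolP[Pm emn] minm.
  apply/eqP; rewrite eqn_leq minm ?andTb; last exact/asboolP.
  by rewrite leqNgt; apply/negP => mn; exact: KP mn Pm k Kk emn.
(* The induction is on a bound [j] for the indices [m], with [e n] kept fixed. *)
have : (n <= n)%N by []; elim: {1 3}n => [|j IH] jn; first by exists 0%N.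
have [K KP] := IH (ltnW jn).
have [Pj|nPj] := pselect (P j); last first.
  by exists K => m; rewrite ltnS leq_eqVlt => /orP[/eqP ->//|]; exact: KP.
have [k0 k0P] : exists k, code k (e j) <> code k (e n).
  by apply: code_separates => /(P_inj _ _ Pj Pn) jn'; move: jn; lia.
exists (maxn K k0) => m; rewrite ltnS leq_eqVlt => /orP[/eqP -> _|mj Pm] k.
  by rewrite geq_max => /andP[_ kk0]; exact: code_neq_mono kk0 k0P.
by rewrite geq_max => /andP[kK _]; exact: KP.
Qed.

(** At the step where [x] leaves the cell of [e n], the index [n] is active: [e n] receives the
    digit 1, and [x] receives 0 or 2 according to [q n x]. *)
Lemma code_side n K x : P n ->
  (forall k, (K <= k)%N -> active (code k) (code k (e n)) = Some n) ->
  code K x = code K (e n) -> ~ comp (e n) x ->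
  (q n x = 0 -> prec x (e n)) /\ (q n x = 1 -> prec (e n) x).
Proof.
move=> Pn KP cK nex.
have ex : exists k, code k x != code k (e n).
  have [k ck] := code_separates _ _ nex.
  by exists k; apply/eqP => /esym.
case: (ex_minnP ex) => -[|k]; first by rewrite eqxx.
move=> ck mink.
have ckE : code k x = code k (e n).
  by apply/eqP; apply: contraT => /mink; rewrite ltnn.
(* A disagreement at level [k.+1] would persist up to [K], where the codes agree. *)
have Kk : (K <= k)%N.
  rewrite leqNgt; apply/negP => kK.
  by apply: (code_neq_mono x (e n) k.+1 K) cK => //; exact/eqP.
move: ck => /=; rewrite ckE /digit ckE KP// (asboolT (iff_refl _)).
case: asboolP => [|Ux]; first by rewrite eqxx.
move=> _; split=> qx; exists k.+1; rewrite /= ckE /digit ckE KP//.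
  by rewrite (asboolT (iff_refl _)) asboolF// qx eq_sym oner_eq0; lia.
by rewrite (asboolT (iff_refl _)) asboolF// qx eqxx; lia.
Qed.

(** * Continuous coordinates monotone for the order *)

Variable K : nat -> nat.
Hypothesis K_active : forall n, P n -> forall k, (K n <= k)%N ->
  active (code k) (code k (e n)) = Some n.

Definition height (n : nat) (x : X) : R :=
  if `[< P n >] then
    if (code (K n) x < code (K n) (e n))%N then 0
    else if (code (K n) (e n) < code (K n) x)%N then 1 else q n x
  else 0.

Lemma height_itv n x : 0 <= height n x <= 1.
Proof.
rewrite /height; case: asboolP => [Pn|_]; last by rewrite lexx ler01.
by do 2 (case: ifP => _; first by rewrite ?lexx ?ler01); exact: q_itv.
Qed.

(** The code at level [K n] is locally constant, so a single branch of the definition applies near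
    each point. *)
Lemma height_continuous n : continuous (height n).
Proof.
move=> x; rewrite /continuous_at {2}/height.
have cx := code_near (K n) x.
case: asboolP => [Pn|nPn]; last first.
  by apply: cvg_near_cst; apply: nearW => y; rewrite /height asboolF.
case: ifPn => [lt|nlt].
  apply: cvg_near_cst; apply: filterS cx => y cy.
  by rewrite /height asboolT// cy lt.
case: ifPn => [gt|ngt].
  apply: cvg_near_cst; apply: filterS cx => y cy.
  by rewrite /height asboolT// cy (negbTE nlt) gt.
apply: cvg_trans (q_continuous n Pn x); apply: near_eq_cvg.
apply: filterS cx => y cy.
by rewrite /height asboolT// cy (negbTE nlt) (negbTE ngt).
Qed.

Lemma prec_height x y n : prec x y -> height n x <= height n y.
Proof.
move=> xy; have [Pn|nPn] := pselect (P n); last by rewrite /height asboolF.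
have := height_itv n x; have := height_itv n y.
rewrite /height asboolT//.
have cxy := prec_le _ _ xy (K n).
have [xlt|xge] := ltnP (code (K n) x) (code (K n) (e n)).
  by move=> /andP[].
have [ygt|yle] := ltnP (code (K n) (e n)) (code (K n) y).
  by rewrite ltnNge (ltnW ygt) /= => _ /andP[].
have cx : code (K n) x = code (K n) (e n) by lia.
have cy : code (K n) y = code (K n) (e n) by lia.
(* Both points are now in the cell of [e n], so the heights are values of [q n]. Off the component
   these are 0 or 1 and tell the side of [e n]; a decrease from [x] to [y] would contradict
   [prec x y]. *)
rewrite cx cy ltnn => /andP[qy0 qy1] /andP[qx0 qx1].
have side z := code_side n (K n) z Pn (K_active n Pn).
have nxy k : (code k y <= code k x)%N -> prec x y -> code k x = code k y.
  by move=> yx /prec_le/(_ k); lia.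
have [ex|nex] := pselect (comp (e n) x);
  have [ey|ney] := pselect (comp (e n) y).
- have [k] := xy.
  by rewrite -(code_comp _ _ k ex) -(code_comp _ _ k ey) ltnn.
- have [|-> //] := q_out n y Pn ney.
  move=> /(side y cy ney).1[k yek].
  by have := prec_le _ _ xy k; rewrite -(code_comp _ _ k ex) leqNgt yek.
- have [-> //|] := q_out n x Pn nex.
  move=> /(side x cx nex).2[k xek].
  by have := prec_le _ _ xy k; rewrite -(code_comp _ _ k ey) leqNgt xek.
- have [->//|/(side x cx nex).2[k exk]] := q_out n x Pn nex.
  have [/(side y cy ney).1[j yej]|->//] := q_out n y Pn ney.
  have exj := code_mono _ _ _ _ (leq_maxl k j) exk.
  have yek := code_mono _ _ _ _ (leq_maxr k j) yej.
  by have := prec_le _ _ xy (maxn k j); lia.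
Qed.

(** Points of one component have equal codes, so they cannot lie on opposite sides of [e n], as
    distinct values 0 and 1 of [q n] would force. *)
Lemma height_comp x y n : comp x y -> ~ comp (e n) x -> height n x = height n y.
Proof.
move=> xy nex; have [Pn|nPn] := pselect (P n); last by rewrite /height asboolF.
rewrite /height asboolT// (code_comp _ _ (K n) xy).
case: ltngtP => // cy.
have cx := code_comp _ _ (K n) xy; rewrite cy in cx.
have ney : ~ comp (e n) y.
  move=> ey; apply: nex; apply: connected_component_trans ey _.
  exact: connected_component_sym.
have side z := code_side n (K n) z Pn (K_active n Pn).
have [qx|qx] := q_out n x Pn nex; have [qy|qy] := q_out n y Pn ney;
  rewrite qx qy //.
  have [k] := (side x cx nex).1 qx; have [j] := (side y cy ney).2 qy.
  rewrite -(code_comp _ _ j xy) => /(code_mono _ _ _ _ (leq_maxl j k)) h1.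
  by move=> /(code_mono _ _ _ _ (leq_maxr j k)) h2; lia.
have [k] := (side x cx nex).2 qx; have [j] := (side y cy ney).1 qy.
rewrite -(code_comp _ _ j xy) => /(code_mono _ _ _ _ (leq_maxl j k)) h1.
by move=> /(code_mono _ _ _ _ (leq_maxr j k)) h2; lia.
Qed.

(** The code part separates components and the height part separates points within one; both being
    monotone, their average loses neither property. *)
Definition coordinate (k : nat) (x : X) : R :=
  ((code k x)%:R / 3 ^+ k + height k x) / 2.

Lemma coordinate_itv k x : 0 <= coordinate k x <= 1.
Proof.
have /andP[h0 h1] := height_itv k x.
have c0 : 0 <= (code k x)%:R / 3 ^+ k :> R by rewrite divr_ge0 ?exprn_ge0.
have c1 : (code k x)%:R / 3 ^+ k <= 1 :> R.
  by rewrite ler_pdivrMr ?exprn_gt0// mul1r -natrX ler_nat ltnW// code_lt.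
by rewrite /coordinate; apply/andP; split; lra.
Qed.

Lemma coordinate_continuous k : continuous (coordinate k).
Proof.
move=> x; apply: cvgMr_tmp; apply: cvgD; last exact: height_continuous.
apply: cvgMr_tmp; apply: cvg_near_cst.
by apply: filterS (code_near k x) => y ->.
Qed.

Lemma coordinate_prec x y : prec x y ->
  (forall k, coordinate k x <= coordinate k y) /\
  exists k, coordinate k x <> coordinate k y.
Proof.
move=> xy; split=> [k|].
  rewrite /coordinate ler_pM2r ?invr_gt0// lerD//; last exact: prec_height.
  by rewrite ler_pM2r ?invr_gt0 ?exprn_gt0// ler_nat prec_le.
have [k kxy] := xy; exists k; apply/eqP.
rewrite /coordinate lt_eqF// ltr_pM2r ?invr_gt0// ltr_leD//.
  by rewrite ltr_pM2r ?invr_gt0 ?exprn_gt0// ltr_nat.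
exact: prec_height.
Qed.

(** Codes are constant on components, and only the height indexed by the component itself varies
    along it. This single coordinate then decides the order of the two points. *)
Lemma coordinate_comp x y : comp x y -> x <> y -> exists n,
  coordinate n x <> coordinate n y /\
  forall m, m <> n -> coordinate m x = coordinate m y.
Proof.
move=> cxy xy; have [n [Pn ex]] := P_cover _ _ xy cxy; exists n; split.
  have ey : comp (e n) y by exact: connected_component_trans ex cxy.
  have hq z : comp (e n) z -> height n z = q n z.
    by move=> ez; rewrite /height asboolT// -(code_comp _ _ (K n) ez) ltnn.
  rewrite /coordinate (code_comp _ _ n cxy) !hq// => qxy.
  by apply: xy; apply: (q_inj n x y) => //; lra.
move=> m mn; rewrite /coordinate (code_comp _ _ m cxy); congr ((_ + _) / _).
have [Pm|nPm] := pselect (P m); last by rewrite /height asboolF.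
apply: height_comp cxy _ => emx; apply: mn; apply: P_inj => //.
by apply: connected_component_trans emx _; exact: connected_component_sym.
Qed.

Lemma coordinate_comonotone x y : x <> y ->
  (forall k, coordinate k x <= coordinate k y) \/
  (forall k, coordinate k y <= coordinate k x).
Proof.
move=> xy; have [cxy|ncxy] := pselect (comp x y); last first.
  have [k /eqP] := code_separates _ _ ncxy; rewrite neq_ltn => /orP[] ck.
    by left; exact: (coordinate_prec x y (ex_intro _ k ck)).1.
  by right; exact: (coordinate_prec y x (ex_intro _ k ck)).1.
have [n [_ eq]] := coordinate_comp _ _ cxy xy.
have [le|/ltW le] := leP (coordinate n x) (coordinate n y); [left|right] => k.
  by have [->//|/eqP/eq ->] := eqVneq k n.
by have [->//|/eqP/eq ->] := eqVneq k n.
Qed.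

Lemma coordinate_separates x y : x <> y ->
  exists k, coordinate k x <> coordinate k y.
Proof.
move=> xy; have [cxy|ncxy] := pselect (comp x y).
  by have [n [? _]] := coordinate_comp _ _ cxy xy; exists n.
have [k /eqP] := code_separates _ _ ncxy; rewrite neq_ltn => /orP[] ck.
  exact: (coordinate_prec x y (ex_intro _ k ck)).2.
have [j /nesym] := (coordinate_prec y x (ex_intro _ k ck)).2.
by exists j.
Qed.

End code.

(** * Assembling the embedding *)

(** The image of the midpoint of the parameter interval is a witness. Being open and non-empty, the
    open arc meets any dense sequence. *)
Lemma arc_interior_nonempty (R : realType) (X : topologicalType) (C : set X)
    (a b : X) : is_arc R C a b -> C `\` [set a; b] !=set0.
Proof.
move=> [s [t [f [st [_ [g [fK _ _]]] fs ft]]]].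
have pt (r : R) : s <= r <= t -> r \in `[s, t]%classic.
  by move=> rst; rewrite inE /= in_itv.
have sP : s <= s <= t by lra.
have tP : s <= t <= t by lra.
have mP : s <= (s + t) / 2 <= t by lra.
pose us : set_type `[s, t]%classic := exist _ s (pt _ sP).
pose ut : set_type `[s, t]%classic := exist _ t (pt _ tP).
pose um : set_type `[s, t]%classic := exist _ ((s + t) / 2) (pt _ mP).
have f_inj u v : \val (f u) = \val (f v) -> \val u = \val v.
  by move=> /val_inj /(can_inj fK) ->.
exists (\val (f um)); split; first exact: set_valP.
move=> [/=|/=].
  by rewrite -(fs us erefl) => /f_inj /=; lra.
by rewrite -(ft ut erefl) => /f_inj /=; lra.
Qed.

Theorem theorem7 (R : realType) (X : metricType R)
  (compactX : compact [set: X])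
  (arc_components : forall x : X,
     nontrivial (connected_component [set: X] x) ->
     exists a b : X,
       is_arc R (connected_component [set: X] x) a b /\
       open (connected_component [set: X] x `\` [set a; b])) :
  exists A : set R, homeomorphic X (set_type A).
Proof.
suff [g [g_cont g_inj]] : exists g : X -> R, continuous g /\ injective g.
  by exists (range g); exact: compact_injective_homeomorphic.
have [[x0 _]|noX] := pselect (exists x : X, True); last first.
  exists (cst 0); split=> [|x]; first exact: cst_continuous.
  by case: noX; exists x.
have hausX : hausdorff_space X by exact: metric_hausdorff.
have [U [U_clopen U_all]] := compact_clopen_seq R X compactX.
have [e e_dense] := compact_dense_seq R X x0 compactX.
pose comp := connected_component [set: X].
have comp_refl x : comp x x by exact: connected_component_refl.
have U_separates x y : ~ comp x y -> exists k, U k x /\ ~ U k y.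
  move=> nxy.
  have [||||A [B [clA clB ABT AB0 [Ax By]]]] :=
    quasicomponent_separation X setT x y hausX compactX => //.
    move=> S _ cS Sx Sy; apply: nxy.
    exact: connected_component_max Sx _ cS y Sy.
  have AB : A = ~` B.
    by apply/seteqP; split=> z; [move=> Az Bz|move=> nBz];
      [rewrite -[False]/(set0 z) -AB0|have : setT z by []; rewrite -ABT => -[]].
  have [|k Uk] := U_all A.
    by split => //; rewrite AB; exact: closed_openC.
  exists k; rewrite Uk; split => //; by rewrite AB; apply.
(* [P] keeps, for each non-trivial component, the least index of a term of [e] lying in it. *)
pose P n :=
  nontrivial (comp (e n)) /\ forall m, (m < n)%N -> ~ comp (e m) (e n).
have P_inj n m : P n -> P m -> comp (e n) (e m) -> n = m.
  move=> [_ minn] [_ minm] enm; apply/eqP; rewrite eqn_leq; apply/andP; split.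
    rewrite leqNgt; apply/negP => /minn; apply.
    exact: connected_component_sym.
  by rewrite leqNgt; apply/negP => /minm; apply.
have P_cover x y : x <> y -> comp x y -> exists n, P n /\ comp (e n) x.
  move=> xy cxy.
  have ntx : nontrivial (comp x) by exists x, y; split.
  have [a [b [ab oab]]] := arc_components x ntx.
  have [n [xen _]] := e_dense _ oab (arc_interior_nonempty _ _ _ _ _ ab).
  have ex : exists n, `[< comp x (e n) >] by exists n; apply/asboolP.
  case: (ex_minnP ex) => m /asboolP xem minm; exists m; split; last first.
    exact: connected_component_sym.
  split; first by rewrite /comp -(same_connected_component xem).
  move=> j jm ejm; suff : (m <= j)%N by rewrite leqNgt jm.
  apply: minm; apply/asboolP; apply: connected_component_trans xem _.
  exact: connected_component_sym.
have /choice[q qP] n : exists qn : X -> R, P n ->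
    [/\ continuous qn, forall y, 0 <= qn y <= 1,
      forall y z, comp (e n) y -> comp (e n) z -> qn y = qn z -> y = z &
      forall y, ~ comp (e n) y -> qn y = 0 \/ qn y = 1].
  have [Pn|nPn] := pselect (P n); last by exists (cst 0).
  have [a [b [ab oab]]] := arc_components _ Pn.1.
  by have [qn] := arc_coordinate R X _ a b hausX compactX ab oab; exists qn.
have q_cont n : P n -> continuous (q n) by move=> /qP[].
have q_itv n x : P n -> 0 <= q n x <= 1 by move=> /qP[_ + _ _]; apply.
have q_inj n x y : P n -> comp (e n) x -> comp (e n) y ->
    q n x = q n y -> x = y.
  by move=> /qP[_ _ + _]; apply.
have q_out n x : P n -> ~ comp (e n) x -> q n x = 0 \/ q n x = 1.
  by move=> /qP[_ _ _]; apply.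
(* [K n] is a level from which [n] stays active in the cell of [e n]; 0 is a dummy value when [P n]
   fails. *)
have /choice[K KP] n : exists Kn, P n -> forall k, (Kn <= k)%N ->
    active e P (code U e P q k) (code U e P q k (e n)) = Some n.
  have [Pn|nPn] := pselect (P n); last by exists 0%N.
  have [Kn] := active_eventually U e P q U_separates P_inj n Pn.
  by exists Kn.
apply: (@comonotone_embedding _ _ (coordinate U e P q K)).
- exact: coordinate_continuous.
- exact: coordinate_itv.
- exact: coordinate_comonotone.
- exact: coordinate_separates.
Qed.
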